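(* Let $d \ge 0$ in $\mathbb{R}^m$ and $l \in \mathbb{R}^m$ satisfy $f(d,l) > 0$, and similarly let $\tilde d \ge 0$ in $\mathbb{R}^m$ and $\tilde l \in \mathbb{R}^m$ satisfy $f(\tilde d,\tilde l) > 0$. Let $1 \le j \le m$, and suppose that $d, l, \tilde d, \tilde l$ satisfy $$\frac{1}{f(\tilde d,\tilde l)}\,\tilde d = \alpha\left(\frac{1}{f(d,l)}\,d + \frac{2}{m-1}\,\frac{1}{\gamma_j(d,l)^2}\,e_j\right)$$ for a scalar $\alpha \ge \frac{m^2-1}{m^2}$. If $\gamma_j(d,l) \ge \tau(A,u)$, then $$\psi(\tilde d,\tilde l) \le \exp\left(-\frac{1}{2(m+1)}\right)\psi(d,l).$$
   Context: Let $A$ be a real $n \times m$ matrix of rank $n$ with $m \ge 2$, all of whose columns $a_1,\dots,a_m \in \mathbb{R}^n$ are nonzero, and let $u \in \mathbb{R}^m$. Assume there is an $m\times m$ matrix $\Lambda \ge 0$ (entrywise) with $A\Lambda = -A$. Inequalities between vectors are componentwise, and $e_j$ is the $j$th coordinate vector of $\mathbb{R}^m$. For $d \in \mathbb{R}^m$ put $D := \mathrm{Diag}(d)$. All weight vectors $d$ considered (in particular $d$ and $\tilde d$) are assumed to be such that $ADA^T$ is positive definite. For $l \in \mathbb{R}^m$ put $r := (u+l)/2$, $v := (u-l)/2$, and define $$f(d,l) := r^TDA^T(ADA^T)^{-1}ADr - r^TDr + v^TDv .$$ When $f(d,l)>0$, define for $i=1,\dots,m$ $$\gamma_i(d,l)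 := \sqrt{f(d,l)\, a_i^T (ADA^T)^{-1} a_i}.$$ (This is the semi-width in direction $a_i$ of the ellipsoid $E(d,l) = \{y\in\mathbb{R}^n : (y-\bar y)^T ADA^T (y-\bar y) \le f(d,l)\}$ with center $\bar y = (ADA^T)^{-1}ADr$.) Define $z(A,u) := \min_{y \in \mathbb{R}^n}\max_{1\le i\le m}(a_i^Ty - u_i)$ and $\tau(A,u) := |z(A,u)|$ (the assumption on $\Lambda$ makes $z(A,u)$ finite). The potential function $\psi$ is $$\psi(d,l) := \prod_{i=1}^m \max\left\{\gamma_i(d,l),\ \frac{m}{m+1}\,\tau(A,u)\right\}.$$ *)

(* Defs.v *)
From HB Require Import structures.
From mathcomp Require Import all_boot all_order all_algebra.
From mathcomp Require Import all_classical all_reals all_analysis.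

Set Implicit Arguments.
Unset Strict Implicit.
Unset Printing Implicit Defensive.

Import Order.TTheory GRing.Theory Num.Theory.
Local Open Scope classical_set_scope.
Local Open Scope ring_scope.

Definition posdefmx (R : realType) (n : nat) (M : 'M[R]_n) : Prop :=
  M^T = M /\ forall x : 'cV[R]_n, x != 0 -> 0 < (x^T *m M *m x) 0 0.

(* Greatest and least elements; the value is 0 if there is none. *)
Definition setmax (R : realType) (S : set R) : R := xget 0 (S `&` ubound S).
Definition setmin (R : realType) (S : set R) : R := xget 0 (S `&` lbound S).

Lemma setmaxE (R : realType) (S : set R) (x : R) :
  S x -> ubound S x -> setmax S = x.
Proof.
move=> Sx ubx; apply: xget_subset1 => // a b [Sa uba] [Sb ubb].
by apply/le_anti; rewrite ubb ?uba.
Qed.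

Lemma setminE (R : realType) (S : set R) (x : R) :
  S x -> lbound S x -> setmin S = x.
Proof.
move=> Sx lbx; apply: xget_subset1 => // a b [Sa lba] [Sb lbb].
by apply/le_anti; rewrite lba ?lbb.
Qed.

(* Vectors are columns, and scalars x^T M y are read off as the entry of a
   1 x 1 matrix.  The column a_i of A is col i A. *)
Section Potential.
Variables (R : realType) (n m : nat).
Implicit Types (A : 'M[R]_(n, m)) (u d l : 'cV[R]_m) (i : 'I_m).

Definition Diag d : 'M[R]_m := diag_mx d^T.

Definition ADAT A d : 'M[R]_n := A *m Diag d *m A^T.

Definition rvec u l : 'cV[R]_m := 2^-1 *: (u + l).
Definition vvec u l : 'cV[R]_m := 2^-1 *: (u - l).

Definition f A u d l : R :=
  let r := rvec u l in
  let v := vvec u l in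
  (r^T *m Diag d *m A^T *m invmx (ADAT A d) *m A *m Diag d *m r) 0 0
  - (r^T *m Diag d *m r) 0 0 + (v^T *m Diag d *m v) 0 0.

Definition gamma A u d l i : R :=
  Num.sqrt (f A u d l * ((col i A)^T *m invmx (ADAT A d) *m col i A) 0 0).

(* max_i (a_i^T y - u_i) *)
Definition maxviol A u (y : 'cV[R]_n) : R :=
  setmax [set ((col i A)^T *m y) 0 0 - u i 0 | i in [set: 'I_m]].

Definition z A u : R := setmin (range (maxviol A u)).

Definition tau A u : R := `|z A u|.

Definition psi A u d l : R :=
  \prod_(i < m) Num.max (gamma A u d l i) (m%:R / (m%:R + 1) * tau A u).

End Potential.

(* Main.v *)
(* Sherman-Morrison inverts the rank-one update exactly: writing
   w_ij = f a_i^T (ADA^T)^-1 a_j, so that w_jj = gamma_j^2, it gives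
     gamma'_i^2 = alpha^-1 (gamma_i^2 - 2/(m+1) * w_ij^2 / gamma_j^2).
   Hence gamma'_i^2 <= m^2/(m^2-1) * gamma_i^2 for every i, while
   gamma'_j <= m/(m+1) * gamma_j.  As gamma_j >= tau, the j-th factor of psi
   shrinks by m/(m+1) <= exp(-1/(m+1)), and each of the m-1 other factors grows
   by at most (m^2/(m^2-1))^(1/2) <= exp(1/(2(m^2-1))); the exponents add up
   to -1/(2(m+1)). *)

Require Import Defs.
From HB Require Import structures.
From mathcomp Require Import all_boot all_order all_algebra.
From mathcomp Require Import all_classical all_reals all_analysis.
From mathcomp Require Import ring lra.

Set Implicit Arguments.
Unset Strict Implicit.

Import Order.TTheory GRing.Theory Num.Theory.
Local Open Scope ring_scope.

Lemma mulmx1_invmx (R : comUnitRingType) (n : nat) (M N : 'M[R]_n) :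
  M *m N = 1%:M -> invmx M = N.
Proof.
move=> MN1; have [Mu _] := mulmx1_unit MN1.
by rewrite -[LHS]mulmx1 -MN1 mulKmx.
Qed.

(** Multiplied by the candidate inverse with coefficient [t = s / (1 + s * q)], the matrix leaves
    [1%:M] plus [s - t - s * t * q] times [a *m b^T *m invmx M], and this choice of [t] makes that
    coefficient zero. *)
Lemma sherman_morrison (R : fieldType) (n : nat) (M : 'M[R]_n) (a b : 'cV[R]_n)
    (s : R) (q := (b^T *m invmx M *m a) 0 0) :
  M \in unitmx -> 1 + s * q != 0 ->
  invmx (M + s *: (a *m b^T)) =
  invmx M - (s / (1 + s * q)) *: (invmx M *m a *m (b^T *m invmx M)).
Proof.
move=> Mu q_neq0; apply: mulmx1_invmx.
have bQa : b^T *m (invmx M *m a) = q%:M by rewrite mulmxA [LHS]mx11_scalar.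
rewrite mulmxBr !mulmxDl mulmxV // -!scalemxAr -!scalemxAl -!mulmxA mulKVmx //.
rewrite (mulmxA (invmx M)) (mulmxA b^T) -(mulmxA b^T) (mulmxA b^T).
rewrite bQa mul_scalar_mx -scalemxAr !scalerA -addrA -scalerDl -scalerBl.
rewrite (_ : _ - _ = 0) ?scale0r ?addr0 //.
by field.
Qed.

Lemma posdefmx_unit (R : realType) (n : nat) (M : 'M[R]_n) :
  posdefmx M -> M \in unitmx.
Proof.
(* [kermx] is a left kernel: applied to [M^T] it yields a row [x] with [M *m x^T = 0], against
   positivity at [x^T]. *)
move=> [_ pos]; rewrite -unitmx_tr -row_free_unit -kermx_eq0; apply: contraT.
case/rowV0Pn => x /sub_kermxP xM x_neq0.
have := pos x^T; rewrite -mulmxA -[M]trmxK -trmx_mul xM trmx0 mulmx0 mxE ltxx.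
by apply; rewrite -trmx0 (inj_eq trmx_inj).
Qed.

(** By symmetry of [M], this is the form of [M] evaluated at [invmx M *m x]. *)
Lemma posdefmx_invmx_gt0 (R : realType) (n : nat) (M : 'M[R]_n) (x : 'cV[R]_n) :
  posdefmx M -> x != 0 -> 0 < (x^T *m invmx M *m x) 0 0.
Proof.
move=> Mpd x_neq0; have Mu := posdefmx_unit Mpd; case: Mpd => Msym pos.
have := pos (invmx M *m x).
rewrite trmx_mul trmx_inv Msym -!mulmxA mulKVmx //; apply.
by apply: contra x_neq0 => /eqP Qx0; rewrite -(mulKVmx Mu x) Qx0 mulmx0.
Qed.

Section RankOneUpdate.
Variables (R : realType) (n m : nat) (A : 'M[R]_(n, m)).

Lemma ADAT_scale (k : R) (d : 'cV[R]_m) : ADAT A (k *: d) = k *: ADAT A d.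
Proof. by rewrite /ADAT /Diag linearZ /= linearZ /= -scalemxAr -scalemxAl. Qed.

Lemma ADAT_add (d e : 'cV[R]_m) : ADAT A (d + e) = ADAT A d + ADAT A e.
Proof. by rewrite /ADAT /Diag linearD /= linearD /= mulmxDr mulmxDl. Qed.

Lemma ADAT_delta (j : 'I_m) : ADAT A (delta_mx j 0) = col j A *m (col j A)^T.
Proof.
rewrite /ADAT /Diag trmx_delta.
have -> : diag_mx (delta_mx 0 j) = delta_mx j 0 *m (delta_mx 0 j : 'M[R]_(1, m)).
  apply/matrixP => x y; rewrite mul_delta_mx !mxE eqxx /= -mulrnA mulnb.
  by case: (x =P j) => //= ->; rewrite eq_sym.
by rewrite mulmxA -colE -mulmxA -rowE tr_col.
Qed.

Lemma gamma_sqr (u d l : 'cV[R]_m) (i : 'I_m) :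
  posdefmx (ADAT A d) -> 0 < f A u d l -> col i A != 0 ->
  gamma A u d l i ^+ 2 =
  f A u d l * ((col i A)^T *m invmx (ADAT A d) *m col i A) 0 0.
Proof.
move=> pd f0 ai; rewrite sqr_sqrtr // mulr_ge0 // ltW //.
exact: posdefmx_invmx_gt0.
Qed.

Lemma gamma_gt0 (u d l : 'cV[R]_m) (i : 'I_m) :
  posdefmx (ADAT A d) -> 0 < f A u d l -> col i A != 0 ->
  0 < gamma A u d l i.
Proof.
by move=> pd f0 ai; rewrite sqrtr_gt0 mulr_gt0 // posdefmx_invmx_gt0.
Qed.

(** The squared semi-widths depend on [d] and [l] only through [d] divided by [f], and the update
    changes that quotient by a scaling and a multiple of one coordinate vector. *)
Lemma gamma_update (u d l d' l' : 'cV[R]_m) (j : 'I_m) (alpha c : R) :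
  posdefmx (ADAT A d) -> 0 < f A u d l -> 0 < f A u d' l' ->
  posdefmx (ADAT A d') -> (forall i, col i A != 0) ->
  0 < alpha -> 0 <= c ->
  (f A u d' l')^-1 *: d' =
    alpha *: ((f A u d l)^-1 *: d
              + (c * (gamma A u d l j ^+ 2)^-1) *: delta_mx j 0) ->
  forall i, gamma A u d' l' i ^+ 2 =
    alpha^-1 * (gamma A u d l i ^+ 2 - c / (1 + c) *
      (f A u d l * ((col i A)^T *m invmx (ADAT A d) *m col j A) 0 0) ^+ 2
        / gamma A u d l j ^+ 2).
Proof.
move=> pd f0 f0' pd' hcol a0 c0 upd i; rewrite !gamma_sqr //.
have q0 := posdefmx_invmx_gt0 pd (hcol j).
rewrite gamma_sqr // in upd; set F := f A u d l in f0 upd *.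
set F' := f A u d' l' in f0' upd *.
set P := ADAT A d in pd upd q0 *.
set q := (_ *m _ *m col j A) 0 0 in upd q0 *.
set w := ((col i A)^T *m _ *m col j A) 0 0.
have F'n : F' != 0 by rewrite gt_eqF.
have Fn : F != 0 by rewrite gt_eqF.
have qn : q != 0 by rewrite gt_eqF.
have an : alpha != 0 by rewrite gt_eqF.
have cn : 1 + c != 0 by rewrite gt_eqF // ltr_wpDr.
(* Since the squared [gamma] at [j] is [F * q], clearing [F] turns [c / (F * q)] into [c / q]; then
   [s * q = c] in Sherman-Morrison. *)
have P'E : ADAT A d' =
    (F' * alpha / F) *: (P + (c / q) *: (col j A *m (col j A)^T)).
  rewrite -[d'](scalerKV F'n) upd !ADAT_scale ADAT_add !ADAT_scale ADAT_delta -/P.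
  rewrite !scalerDr !scalerA; congr (_ + _ *: _).
  by field; rewrite Fn qn.
have cqE : c / q * q = c by rewrite divfK.
rewrite P'E invmxZ -?P'E ?posdefmx_unit // sherman_morrison ?posdefmx_unit -/q ?cqE //.
(* Symmetry of [P] makes both outer factors of the correction equal to [w], hence the square. *)
have wE : (col j A)^T *m invmx P *m col i A = w%:M.
  have -> : w%:M = ((col i A)^T *m invmx P *m col j A)^T.
    by rewrite [X in X^T]mx11_scalar tr_scalar_mx.
  by rewrite !trmx_mul trmxK trmx_inv pd.1 mulmxA.
rewrite -scalemxAr -scalemxAl mulmxBr mulmxBl -scalemxAr -scalemxAl.
rewrite -!mulmxA (mulmxA (col j A)^T) wE.
rewrite !mul_mx_scalar -!scalemxAr !mulmxA.
(* With [X] and [Y] abstract, [mxE] reads off the entry without expanding the matrix products into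
   sums. *)
have scaleE (k t s : R) (X Y : 'M[R]_1) :
    (k *: (X - t *: (s *: Y))) 0 0 = k * (X 0 0 - t * (s * Y 0 0)).
  by rewrite !mxE.
rewrite scaleE -/w.
by field; rewrite Fn F'n qn an cn.
Qed.

End RankOneUpdate.

Theorem lemma1 (R : realType) (n m : nat) (A : 'M[R]_(n, m)) (u : 'cV[R]_m)
    (hm : (2 <= m)%N) (hrank : \rank A = n)
    (hcol : forall i : 'I_m, col i A != 0)
    (hLambda : exists Lambda : 'M[R]_m,
       (forall i k, 0 <= Lambda i k) /\ A *m Lambda = - A)
    (d l d' l' : 'cV[R]_m)
    (hd : forall i, 0 <= d i 0) (hpd : posdefmx (ADAT A d))
    (hf : 0 < f A u d l)
    (hd' : forall i, 0 <= d' i 0) (hpd' : posdefmx (ADAT A d'))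
    (hf' : 0 < f A u d' l')
    (j : 'I_m) (alpha : R)
    (halpha : (m%:R ^+ 2 - 1) / m%:R ^+ 2 <= alpha)
    (hupdate : (f A u d' l')^-1 *: d' =
       alpha *: ((f A u d l)^-1 *: d
                 + (2 / (m%:R - 1) * ((gamma A u d l j) ^+ 2)^-1)
                     *: delta_mx j 0))
    (hgamma : tau A u <= gamma A u d l j) :
  psi A u d' l' <= expR (- (1 / (2 * (m%:R + 1)))) * psi A u d l.
Proof.
set x : R := m%:R in halpha hupdate *.
have x2 : 2 <= x by rewrite ler_nat.
have x2m1_gt0 : 0 < x ^+ 2 - 1 by nra.
have xsq_gt0 : 0 < x ^+ 2 by nra.
have a0 : 0 < alpha by apply: lt_le_trans halpha; rewrite divr_gt0.
have c0 : 0 <= 2 / (x - 1) by rewrite divr_ge0 //; lra.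
have aV : alpha^-1 <= x ^+ 2 / (x ^+ 2 - 1).
  by rewrite -[leRHS]invrK invf_div lef_pV2 // posrE ?divr_gt0.
have aV0 : 0 <= alpha^-1 by rewrite invr_ge0 ltW.
have g_gt0 i : 0 < gamma A u d l i by exact: gamma_gt0.
have g'_gt0 i : 0 < gamma A u d' l' i by exact: gamma_gt0.
have upd := gamma_update hpd hf hf' hpd' hcol a0 c0 hupdate.
have cE : 2 / (x - 1) / (1 + 2 / (x - 1)) = 2 / (x + 1).
  by field; rewrite !gt_eqF //; lra.
rewrite cE in upd.
have tau0 : 0 <= tau A u by exact: normr_ge0.
have ratio0 : 0 <= x / (x + 1) by rewrite divr_ge0 //; lra.
pose t := x / (x + 1) * tau A u.
have t0 : 0 <= t by rewrite mulr_ge0.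
have g'j : gamma A u d' l' j <= x / (x + 1) * gamma A u d l j.
  rewrite -(@ler_pXn2r _ 2) ?nnegrE //; [|exact: ltW|by rewrite mulr_ge0 // ltW].
  rewrite upd -gamma_sqr // -mulrA.
  (* For [i = j] the correction is [2 / (x + 1) * g ^+ 2], leaving the factor
     [(x - 1) / (x + 1)]. *)
  set g := gamma A u d l j.
  have -> : 2 / (x + 1) * ((g ^+ 2) ^+ 2 / g ^+ 2) = 2 / (x + 1) * g ^+ 2.
    by congr (_ * _); rewrite [X in X / _]expr2 mulfK // sqrf_eq0 (gt_eqF (g_gt0 j)).
  rewrite -[X in X - _]mul1r -mulrBl mulrA [leRHS]exprMn ler_wpM2r ?sqr_ge0 //.
  have -> : (x / (x + 1)) ^+ 2 = x ^+ 2 / (x ^+ 2 - 1) * (1 - 2 / (x + 1)).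
    by field; rewrite !gt_eqF //; lra.
  by rewrite ler_wpM2r // subr_ge0 ler_pdivrMr; lra.
pose b := expR (1 / (2 * (x ^+ 2 - 1))).
have b1 : 1 <= b by rewrite -[1]expR0 ler_expR divr_ge0 //; lra.
have b0 : 0 <= b by exact: expR_ge0.
have bsq : x ^+ 2 / (x ^+ 2 - 1) <= b ^+ 2.
  rewrite -expRM_natl; apply: le_trans (expR_ge1Dx _); rewrite le_eqVlt.
  by apply/orP; left; apply/eqP; field; rewrite gt_eqF.
have g'i i : gamma A u d' l' i <= b * gamma A u d l i.
  rewrite -(@ler_pXn2r _ 2) ?nnegrE //; [|exact: ltW|by rewrite mulr_ge0 // ltW].
  rewrite upd [leRHS]exprMn.
  apply: ler_pM => //; last 2 first.
  - exact: le_trans aV bsq.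
  - rewrite gerBl -mulrA mulr_ge0 // ?divr_ge0 ?sqr_ge0 //; lra.
  (* The bracket is nonnegative because its product with the positive [alpha^-1] is a square. *)
  by rewrite -(pmulr_rge0 _ (x := alpha^-1)) ?invr_gt0 // -upd sqr_ge0.
pose p i := Num.max (gamma A u d l i) t.
have p0 i : 0 <= p i by rewrite le_max t0 orbT.
have rest : \prod_(i < m | i != j) Num.max (gamma A u d' l' i) t <=
            b ^+ m.-1 * \prod_(i < m | i != j) p i.
  rewrite (_ : b ^+ m.-1 = \prod_(i < m | i != j) b); last first.
    by rewrite prodr_const cardC1 card_ord.
  (* The floor [t] is the same in both potentials, and [t <= b * t] because [1 <= b]. *)
  rewrite -big_split /=; apply: ler_prod => i _.
  rewrite le_max t0 orbT /= ge_max maxr_pMr //.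
  rewrite !le_max g'i /=; apply/orP; right; exact: ler_peMl.
(* The factor [x / (x + 1)] built into [t] lets [hgamma] bound the floor by the same contraction as
   the semi-width. *)
have head : Num.max (gamma A u d' l' j) t <= x / (x + 1) * p j.
  rewrite ge_max (le_trans g'j) ?ler_wpM2l ?le_max ?lexx //=.
  by rewrite (le_trans hgamma) // le_max lexx.
have scalar : x / (x + 1) * b ^+ m.-1 <= expR (- (1 / (2 * (x + 1)))).
  have xm1 : m.-1%:R = x - 1 by rewrite -subn1 natrB // (leq_trans _ hm).
  (* The second summand is the exponent of [b ^+ m.-1]; the first bounds
     [x / (x + 1) = 1 - 1 / (x + 1)]. *)
  have -> : - (1 / (2 * (x + 1))) =
      - (1 / (x + 1)) + m.-1%:R * (1 / (2 * (x ^+ 2 - 1))).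
    rewrite xm1; field; rewrite !gt_eqF //; lra.
  rewrite expRD expRM_natl ler_wpM2r ?exprn_ge0 //.
  apply: le_trans (expR_ge1Dx _); rewrite le_eqVlt.
  by apply/orP; left; apply/eqP; field; rewrite gt_eqF //; lra.
rewrite /psi -/x -/t (bigD1 j) //= [X in _ <= _ * X](bigD1 j) //= -/(p j).
apply: (@le_trans _ _ ((x / (x + 1) * p j) *
                       (b ^+ m.-1 * \prod_(i < m | i != j) p i))).
  apply: ler_pM => //; first by rewrite le_max t0 orbT.
  by apply: prodr_ge0 => i _; rewrite le_max t0 orbT.
by rewrite mulrACA ler_wpM2r // mulr_ge0 //; apply: prodr_ge0.
Qed.
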